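(* Let the penalty parameter $\lambda$ be sufficiently large, let $\{\boldsymbol\phi_i\}_{i=1}^N$ be a basis of the finite element space $\boldsymbol V_h$, and let $A\in\mathbb R^{N\times N}$ be the associated stiffness matrix of the discrete bilinear form $\mathcal A_h$, i.e. $(AW,V)_N=\mathcal A_h(\boldsymbol w_h,\boldsymbol v_h)$ for $\boldsymbol w_h=\sum_iW_i\boldsymbol\phi_i$, $\boldsymbol v_h=\sum_iV_i\boldsymbol\phi_i$. The condition number of $A$ satisfies $$\mathcal K(A)\le\frac{c_2\,C_2^2\,C_I^2}{c_1\,C_1^2\,C_P^2}\,h^{-6},$$ where $c_1,c_2,C_1,C_2,C_I,C_P$ are the constants in the following estimates, which hold for all $\boldsymbol w_h=\sum_iW_i\boldsymbol\phi_i$ and $\boldsymbol v_h$ in $\boldsymbol V_h$: (i) $|\mathcal A_h(\boldsymbol w_h,\boldsymbol v_h)|\le c_2|\!|\!|\boldsymbol w_h|\!|\!|_*|\!|\!|\boldsymbol v_h|\!|\!|_*$ and $\mathcal A_h(\boldsymbol w_h,\boldsymbol w_h)\ge c_1|\!|\!|\boldsymbol w_h|\!|\!|_*^2$; (ii) $\|\boldsymbol w_h\|_{\Omega_{h,-}\cup\Omega_{h,+}}\le C_2|W|_N$ and $\|\boldsymbol w_h\|_{\Omega_{h,-}\cup\Omega_{h,+}}+\|\nabla\times\boldsymbol w_h\|_{\Omega_{h,-}\cup\Omega_{h,+}}\ge hC_1|W|_N$; (iii) $|\!|\!|\boldsymbol v_h|\!|\!|_*\le C_Ih^{-2}\|\boldsymbol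 v_h\|_{\Omega_{h,-}\cup\Omega_{h,+}}$ and $|\!|\!|\boldsymbol v_h|\!|\!|_*\ge C_P(\|\boldsymbol v_h\|_{\Omega_{h,-}\cup\Omega_{h,+}}+\|\nabla\times\boldsymbol v_h\|_{\Omega_{h,-}\cup\Omega_{h,+}})$.
   Context: Constants are understood to be positive and independent of the mesh size and of the location of the interface $\Gamma$. Domain and operators. $\Omega\subset\mathbb R^2$ is a bounded convex polygonal domain with Lipschitz boundary; $\Gamma$ is a $C^2$-smooth curve (the interface) dividing $\Omega$ into two disjoint subdomains $\Omega_-$ and $\Omega_+$; $\boldsymbol n$ on $\Gamma$ is the unit normal pointing from $\Omega_-$ to $\Omega_+$. For vectors $\boldsymbol u\times\boldsymbol w=u_1w_2-u_2w_1$; $\nabla\times\boldsymbol u=\partial_1u_2-\partial_2u_1$; for a scalar $v$, $\boldsymbol\nabla\times v=(\partial_2v,-\partial_1v)^T$; $\nabla_h\cdot$ is the divergence taken piecewise. $\alpha=\alpha_\pm>0$ is constant in $\Omega_\pm$; $\gamma\ge0$ is a constant. Mesh. $\mathcal T_h$ is a quasi-uniform, shape-regular triangulation of $\Omega$, generated independently of $\Gamma$; $h$ is the maximal element diameter. $\mathcal T_h^\Gamma=\{K\in\mathcal T_h:K\cap\Gamma\ne\emptyset\}$ (interface elements), $\Gamma_K$ is the part of $\Gamma$ in $K$, and for $j=\pm$, $\mathcal T_{h,j}=\{K\in\mathcal T_h:K\cap\Omega_j\neq\emptyset\}$, $\Omega_{h,j}=\bigcup_{K\in\mathcal T_{h,j}}K$.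 $\mathcal E_h$ is the set of edges of elements of $\mathcal T_h$ not contained in $\partial\Omega$; $\mathcal E_h^\Gamma$ is the set of edges of elements of $\mathcal T_h^\Gamma$ not contained in $\partial\Omega$. Mesh assumptions: (1) $\Gamma$ intersects the boundary $\partial K$ of each interface element precisely twice, and each (open) edge at most once; (2) a finite number of edges is adequate to traverse continuously from an interface element to a non-interface element. Finite element space. For a scalar function $u$ let $\mathfrak p u=\int_0^1t\,\boldsymbol x^\perp u(t\boldsymbol x)\,dt$ with $\boldsymbol x=(x_1,x_2)^T$, $\boldsymbol x^\perp=(-x_2,x_1)^T$. The shape function space on $K\in\mathcal T_h$ is $\mathcal S_h(K)=[P_2(K)]^2\oplus\mathrm{span}\{\mathfrak pB\}$, where $[P_2(K)]^2$ is the space of vector-valued polynomials of degree at most 2 and $B=\lambda_1\lambda_2\lambda_3$ with barycentric coordinates $\lambda_i$. The degrees of freedom of $\boldsymbol u\in\mathcal S_h(K)$ are: the values $(\nabla\times\boldsymbol u)(v_i)$ at the three vertices $v_i$ of $K$; the moments $\int_{e_i}\boldsymbol u\cdot\boldsymbol\tau_i\,q\,ds$ for all $q\in P_2(e_i)$ on the three edges $e_i$ with unit tangent vectors $\boldsymbol\tau_i$; and the interior moment $\int_K\boldsymbol u\cdot\boldsymbol q\,dx$ for $\boldsymbol q\in\{\boldsymbol x\}$. $\mathcal S_h(\mathcal T_{h,j})$ is the curl-curl conforming finite element space on $\mathcal T_{h,j}$ obtained by assembling the shape functions on neighboring elements using these degrees of freedom. Then $$\boldsymbol V_h=\{\boldsymbol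 v_h=\{\boldsymbol v_h^-,\boldsymbol v_h^+\}:\boldsymbol v_h^j\in\mathcal S_h(\mathcal T_{h,j}),\ j=\pm,\ \boldsymbol n\times\boldsymbol v_h^+=\nabla\times\boldsymbol v_h^+=0\text{ on }\partial\Omega\},$$ with $\boldsymbol n$ on $\partial\Omega$ the unit normal. In integrals over $\Omega_-\cup\Omega_+$, and in the integrals over edges in $\mathcal E_h$ in $\mathcal G_0$ below, $\boldsymbol v_h$ is the function on $\Omega$ equal to $\boldsymbol v_h^j$ in $\Omega_j$. $\|\cdot\|_D$ is the $L^2(D)$ norm; $\|\cdot\|^2_{\Omega_-\cup\Omega_+}=\sum_{j}\|\cdot\|^2_{\Omega_j}$; $\|\boldsymbol v_h\|^2_{\Omega_{h,-}\cup\Omega_{h,+}}=\sum_j\|\boldsymbol v_h^j\|^2_{\Omega_{h,j}}$, similarly for derivatives. Jumps, averages, penalties. On $\Gamma$, $[\![v]\!]=v^--v^+$ and $\{\!\!\{v\}\!\!\}=\kappa_1v^-+\kappa_2v^+$ with constants $\kappa_1+\kappa_2=1$; on an edge $E$, $[\![\cdot]\!]$ is the jump across $E$ and $\boldsymbol n$ a unit normal of $E$. $\lambda$ is the penalty parameter. $$\mathcal G_0(\boldsymbol u,\boldsymbol v)=\sum_{K\in\mathcal T_h^\Gamma}h^{-3}\int_{\Gamma_K}[\![\boldsymbol n\cdot\boldsymbol u]\!][\![\boldsymbol n\cdot\boldsymbol v]\!]ds+\sum_{E\in\mathcal E_h}h^{-3}\int_E[\![\boldsymbol n\cdot\boldsymbol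 u]\!][\![\boldsymbol n\cdot\boldsymbol v]\!]ds,$$ $$\mathcal G_1(\boldsymbol u,\boldsymbol v)=\lambda\sum_{K\in\mathcal T_h^\Gamma}h^{-3}\int_{\Gamma_K}[\![\boldsymbol n\times\boldsymbol u]\!][\![\boldsymbol n\times\boldsymbol v]\!]ds,\quad \mathcal G_2(\boldsymbol u,\boldsymbol v)=\lambda\sum_{K\in\mathcal T_h^\Gamma}h^{-1}\int_{\Gamma_K}[\![\nabla\times\boldsymbol u]\!][\![\nabla\times\boldsymbol v]\!]ds,$$ $$J_1(\boldsymbol u,\boldsymbol v)=\sum_{E\in\mathcal E_h^\Gamma}\sum_{0\le l\le4}h^{2l-1}\int_E[\![\partial_n^l\boldsymbol u]\!]\cdot[\![\partial_n^l\boldsymbol v]\!]ds,\quad J_2(\boldsymbol u,\boldsymbol v)=\sum_{E\in\mathcal E_h^\Gamma}\sum_{0\le l\le4}h^{2l-1}\int_E[\![\partial_n^l(\nabla\times\boldsymbol u)]\!][\![\partial_n^l(\nabla\times\boldsymbol v)]\!]ds,$$ with $\partial_n^lq=\sum_{|m|=l}D^mq\,\boldsymbol n^m$ for multi-indices $m=(m_1,m_2)$, $\boldsymbol n^m=n_1^{m_1}n_2^{m_2}$; for pairs $\{\boldsymbol u^-,\boldsymbol u^+\},\{\boldsymbol v^-,\boldsymbol v^+\}$, $J_1$ and $J_2$ are summed over $i=\pm$ using jumps of the $i$-components over edges $E\in\mathcal E_h^\Gamma$ shared by two elements of $\mathcal T_{h,i}$. Bilinear form. $\mathcal A_h=a_h+J_1+J_2$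 with $$\begin{aligned}a_h(\boldsymbol u,\boldsymbol v)=&\int_{\Omega_-\cup\Omega_+}(\alpha\boldsymbol\nabla\times\nabla\times\boldsymbol u)\cdot(\boldsymbol\nabla\times\nabla\times\boldsymbol v)+\gamma\boldsymbol u\cdot\boldsymbol v\,dA\\&+\int_\Gamma\{\!\!\{\boldsymbol n\times(\alpha\boldsymbol\nabla\times\nabla\times\boldsymbol u)\}\!\!\}[\![\nabla\times\boldsymbol v]\!]+\{\!\!\{\boldsymbol n\times(\alpha\boldsymbol\nabla\times\nabla\times\boldsymbol v)\}\!\!\}[\![\nabla\times\boldsymbol u]\!]ds\\&-\int_\Gamma\{\!\!\{\nabla\times(\alpha\boldsymbol\nabla\times\nabla\times\boldsymbol u)\}\!\!\}[\![\boldsymbol n\times\boldsymbol v]\!]+\{\!\!\{\nabla\times(\alpha\boldsymbol\nabla\times\nabla\times\boldsymbol v)\}\!\!\}[\![\boldsymbol n\times\boldsymbol u]\!]ds\\&+h^{-2}\int_{\Omega_-\cup\Omega_+}(\nabla_h\cdot\boldsymbol u)(\nabla_h\cdot\boldsymbol v)dA+\sum_{i=0}^2\mathcal G_i(\boldsymbol u,\boldsymbol v).\end{aligned}$$ Discrete norm. $$|\!|\!|\boldsymbol v|\!|\!|_*^2=\|\boldsymbol\nabla\times\nabla\times\boldsymbol v\|^2_{\Omega_{h,-}\cup\Omega_{h,+}}+\|\boldsymbol v\|^2_{\Omega_{h,-}\cup\Omega_{h,+}}+h^{-2}\|\nabla_h\cdot\boldsymbol v\|^2_{\Omega_-\cup\Omega_+}+\sum_{i=0}^2\mathcal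 G_i(\boldsymbol v,\boldsymbol v)+\sum_{i=1}^2J_i(\boldsymbol v,\boldsymbol v).$$ Matrix norms. $(W,V)_N=\sum_{i=1}^NW_iV_i$, $|W|_N=(W,W)_N^{1/2}$, $\|A\|=\sup_{W\in\mathbb R^N}|AW|_N/|W|_N$ (over $W\neq0$), and $\mathcal K(A)=\|A\|\,\|A^{-1}\|$. *)

(* Defs.v *)
From HB Require Import structures.
From mathcomp Require Import all_boot all_order all_algebra.
From mathcomp Require Import all_classical all_reals all_analysis.

Set Implicit Arguments.
Unset Strict Implicit.
Unset Printing Implicit Defensive.

Import Order.TTheory GRing.Theory Num.Theory.
Import numFieldNormedType.Exports.

Local Open Scope classical_set_scope.
Local Open Scope ring_scope.

Section Plane.
Variable R : realType.
Implicit Types (x y u w : R * R) (A : set (R * R)).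

Definition dot u w : R := u.1 * w.1 + u.2 * w.2.
Definition cross u w : R := u.1 * w.2 - u.2 * w.1.
Definition perp x : R * R := (- x.2, x.1).

(* The library norm of [R * R] is the max norm, hence this one. *)
Definition enorm x : R := Num.sqrt (dot x x).

Definition area := (@lebesgue_measure R \x @lebesgue_measure R)%E.

Definition bd A : set (R * R) := closure A `\` interior A.

Definition diam A : R := sup [set d | exists x y, [/\ A x, A y & d = enorm (x - y)]].

Definition hull (T : finType) (S : {set T}) (p : T -> R * R) : set (R * R) :=
  [set x | exists w : T -> R,
     [/\ forall i, 0 <= w i, forall i, i \notin S -> w i = 0,
         \sum_i w i = 1 & x = \sum_i w i *: p i]].

(* A bounded convex open set automatically has a Lipschitz boundary. *)
Definition convex_polygon (Omega : set (R * R)) : Prop :=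
  Omega !=set0 /\
  exists (m : nat) (p : 'I_m -> R * R), Omega = interior (hull [set: 'I_m] p).

End Plane.

Section Operators.
Variable R : realType.
Implicit Types (q : R * R -> R) (u : R * R -> R * R).

Definition d1 q : R * R -> R := fun x => 'D_((1, 0) : R * R) q x.
Definition d2 q : R * R -> R := fun x => 'D_((0, 1) : R * R) q x.

Definition scurl u : R * R -> R :=
  fun x => d1 (fun y => (u y).2) x - d2 (fun y => (u y).1) x.
Definition vcurl q : R * R -> R * R := fun x => (d2 q x, - d1 q x).
Definition curlcurl u : R * R -> R * R := vcurl (scurl u).
Definition div2 u : R * R -> R :=
  fun x => d1 (fun y => (u y).1) x + d2 (fun y => (u y).2) x.

Definition mderiv (m1 m2 : nat) q : R * R -> R := iter m1 d1 (iter m2 d2 q).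

(* The sum over multi-indices carries no multinomial coefficients. *)
Definition dn (n : R * R) (l : nat) q : R * R -> R :=
  fun x => \sum_(k < l.+1) mderiv k (l - k) q x * (n.1 ^+ k * n.2 ^+ (l - k)).
Definition vdn (n : R * R) (l : nat) u : R * R -> R * R :=
  fun x => (dn n l (fun y => (u y).1) x, dn n l (fun y => (u y).2) x).

Definition frakp q : R * R -> R * R := fun x =>
  (\int[@lebesgue_measure R]_(t in `[0, 1]) (t * (perp x).1 * q (t *: x)),
   \int[@lebesgue_measure R]_(t in `[0, 1]) (t * (perp x).2 * q (t *: x))).

Definition P2 q : Prop := exists c : 'I_3 -> 'I_3 -> R, forall x,
  q x = \sum_(i < 3) \sum_(j < 3 | (i + j <= 2)%N) c i j * x.1 ^+ i * x.2 ^+ j.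

End Operators.

(* The two sides: the subscripts - and +. *)
Definition minus : bool := false.
Definition plus : bool := true.

(* The curve is [t |-> (ig1 t, ig2 t)] for [0 <= t <= ilen]; only the values on
   that interval matter for an open arc (C^2 up to its end points), while a
   closed curve is given by [ilen]-periodic functions. *)
Record interface (R : realType) := Interface {
  ig1 : R -> R;
  ig2 : R -> R;
  ilen : R;
  iOm : bool -> set (R * R) }.

Section Interface.
Variable R : realType.
Implicit Type I : interface R.

Definition ipt I (t : R) : R * R := (ig1 I t, ig2 I t).
Definition iGam I : set (R * R) := ipt I @` `[0, ilen I].
Definition inrm I (t : R) : R * R := (derive1 (ig2 I) t, - derive1 (ig1 I) t).

Definition is_C2 (f : R -> R) : Prop :=
  [/\ forall t, derivable f t 1, forall t, derivable (derive1 f) t 1 &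
      continuous (derive1 (derive1 f))].

(* The curve is parametrised by arc length, so that [ds] is [dt] and [inrm] is
   a unit normal; its direction is fixed so that [inrm] points from the minus
   side to the plus side. *)
Definition is_interface (Omega : set (R * R)) I : Prop :=
  [/\ 0 < ilen I, is_C2 (ig1 I), is_C2 (ig2 I) &
      forall t, 0 <= t <= ilen I ->
        derive1 (ig1 I) t ^+ 2 + derive1 (ig2 I) t ^+ 2 = 1] /\
  ( [/\ forall t, ipt I (t + ilen I) = ipt I t,
        {in `[0, ilen I[ &, injective (ipt I)} &
        iGam I `<=` Omega]
    \/
    [/\ {in `[0, ilen I] &, injective (ipt I)},
        forall t, 0 < t < ilen I -> Omega (ipt I t),
        bd Omega (ipt I 0) & bd Omega (ipt I (ilen I))] ) /\
  [/\ forall j, [/\ open (iOm I j), connected (iOm I j) & iOm I j !=set0],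
      iOm I minus `&` iOm I plus = set0,
      Omega `\` iGam I = iOm I minus `|` iOm I plus &
      forall t, 0 < t < ilen I -> \forall e \near 0^'+,
        iOm I minus (ipt I t - e *: inrm I t) /\
        iOm I plus (ipt I t + e *: inrm I t)].

End Interface.

Record mesh (R : realType) := Mesh {
  mnv : nat;
  mne : nat;
  mnode : 'I_mnv -> R * R;
  melt : 'I_mne -> 'I_3 -> 'I_mnv }.

Section Mesh.
Variables (R : realType) (M : mesh R).

Local Notation node := 'I_(mnv M).
Local Notation elt := 'I_(mne M).

Implicit Types (K : elt) (E : node * node).

Definition verts K : {set node} := [set melt K i | i in 'I_3].
Definition tri K : set (R * R) := hull (verts K) (@mnode R M).
Definition vtx K (i : 'I_3) : R * R := mnode (melt K i).

Definition bary K (i : 'I_3) (x : R * R) : R :=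
  cross (x - vtx K (ordS i)) (vtx K (ordS (ordS i)) - vtx K (ordS i)) /
  cross (vtx K i - vtx K (ordS i)) (vtx K (ordS (ordS i)) - vtx K (ordS i)).

Definition bubble K (x : R * R) : R := \prod_(i < 3) bary K i x.

Definition mesh_size : R := \big[Num.max/0]_K diam (tri K).

Definition triangulation (Omega : set (R * R)) : Prop :=
  [/\ injective (@mnode R M),
      forall K, cross (vtx K 1 - vtx K 0) (vtx K 2 - vtx K 0) != 0,
      \bigcup_K tri K = closure Omega &
      forall K K', K != K' ->
        verts K != verts K' /\
        tri K `&` tri K' = hull (verts K :&: verts K') (@mnode R M)].

Definition shape_regular (sigma : R) : Prop := forall K,
  exists (c : R * R) (r : R),
    [/\ 0 < r, [set x | enorm (x - c) <= r] `<=` tri K &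
        diam (tri K) <= sigma * r].

Definition quasi_uniform (rho : R) : Prop := forall K,
  mesh_size <= rho * diam (tri K).

(* An edge is the increasing pair of its end points; this also orients it. *)
Definition has_edge K E : bool :=
  [&& (E.1 < E.2)%N, E.1 \in verts K & E.2 \in verts K].

Definition seg E : set (R * R) := hull [set E.1; E.2] (@mnode R M).
Definition open_seg E : set (R * R) :=
  seg E `\` [set mnode E.1; mnode E.2].

Definition elen E : R := enorm (mnode E.2 - mnode E.1).
Definition etan E : R * R := (elen E)^-1 *: (mnode E.2 - mnode E.1).
Definition enrm E : R * R := ((etan E).2, - (etan E).1).

Definition edge_int E (f : R * R -> R) : R :=
  elen E * \int[@lebesgue_measure R]_(t in `[0, 1])
             f (mnode E.1 + t *: (mnode E.2 - mnode E.1)).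

(* Jump across [E] of a piecewise quantity between the two elements of [P] that
   share [E]. The order of these elements is irrelevant below, where only
   products of two jumps across the same edge occur. *)
Definition jump (V : zmodType) (P : pred elt) E
    (q : elt -> R * R -> V) (x : R * R) : V :=
  if [seq K <- enum 'I_(mne M) | P K && has_edge K E] is [:: K; K']
  then q K x - q K' x else 0.

Section MeshInterface.
Variables (Omega : set (R * R)) (I : interface R).

Definition in_ThG : pred elt := fun K => `[< tri K `&` iGam I !=set0 >].
Definition in_Th (j : bool) : pred elt :=
  fun K => `[< tri K `&` iOm I j !=set0 >].

Definition in_Eh : pred (node * node) := fun E =>
  [exists K, has_edge K E] && ~~ `[< seg E `<=` bd Omega >].
Definition in_EhG : pred (node * node) := fun E =>
  [exists K, in_ThG K && has_edge K E] && ~~ `[< seg E `<=` bd Omega >].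

Definition share_edge : rel elt := fun K K' => #|verts K :&: verts K'| == 2.

Definition mesh_assumption1 : Prop :=
  (forall K, in_ThG K -> exists x y, x != y /\
     bd (tri K) `&` iGam I = [set x; y]) /\
  (forall K E, has_edge K E ->
     forall x y, (open_seg E `&` iGam I) x -> (open_seg E `&` iGam I) y ->
     x = y).

(* [m] bounds the number of edges to cross. *)
Definition mesh_assumption2 (m : nat) : Prop :=
  forall K, in_ThG K -> exists s : seq elt,
    [/\ (size s <= m)%N, path share_edge K s & ~~ in_ThG (last K s)].

Definition Sh K (u : R * R -> R * R) : Prop :=
  exists (p1 p2 : R * R -> R) (c : R),
    [/\ P2 p1, P2 p2 & forall x, u x = (p1 x, p2 x) + c *: frakp (bubble K) x].

(* The degrees of freedom of shape functions; the interior moment belongs to a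
   single element and hence plays no role in the assembly. *)
Definition dof_vertex (a : node) (u : R * R -> R * R) : R := scurl u (mnode a).
Definition dof_edge E (q : R * R -> R) (u : R * R -> R * R) : R :=
  edge_int E (fun x => dot (u x) (etan E) * q x).

(* A discrete function has one shape function per element, as its normal
   component is two-valued on edges; it is extended by 0 to the elements
   outside [in_Th j], so that equality is equality of discrete functions. *)
Definition Sh_Th (j : bool) (u : elt -> R * R -> R * R) : Prop :=
  [/\ forall K, in_Th j K -> Sh K (u K),
      forall K, ~~ in_Th j K -> u K = 0,
      forall K K' a, in_Th j K -> in_Th j K' ->
        a \in verts K -> a \in verts K' ->
        dof_vertex a (u K) = dof_vertex a (u K') &
      forall K K' E q, in_Th j K -> in_Th j K' ->
        has_edge K E -> has_edge K' E -> P2 q ->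
        dof_edge E q (u K) = dof_edge E q (u K')].

Definition pwfun := bool -> elt -> R * R -> R * R.
Implicit Types u v : pwfun.

Definition Vh v : Prop :=
  [/\ forall j, Sh_Th j (v j),
      forall K E x, in_Th plus K -> has_edge K E -> seg E `<=` bd Omega ->
        seg E x -> cross (enrm E) (v plus K x) = 0 &
      forall K x, in_Th plus K -> tri K x -> bd Omega x ->
        scurl (v plus K) x = 0].

Definition lincomb (N : nat) (phi : 'I_N -> pwfun) (W : 'cV[R]_N) : pwfun :=
  fun j K x => \sum_i W i 0 *: phi i j K x.

(* Linearly independent with span [Vh]. *)
Definition Vh_basis (N : nat) (phi : 'I_N -> pwfun) : Prop :=
  (forall W, lincomb phi W = (fun _ _ _ => 0) -> W = 0) /\
  (forall v, Vh v <-> exists W, v = lincomb phi W).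

Variables (alpha : bool -> R) (gamma kappa1 kappa2 lambda : R).

Local Notation h := mesh_size.

(* [int_Om] is over the two subdomains, [int_Omh] over the two overlapping unions of
   elements of a piecewise quantity with one value per side and element. *)
Definition int_Om (f : bool -> elt -> R * R -> R) : R :=
  \sum_(j : bool) \sum_(K | in_Th j K)
    \int[@area R]_(x in tri K `&` iOm I j) f j K x.
Definition int_Omh (f : bool -> elt -> R * R -> R) : R :=
  \sum_(j : bool) \sum_(K | in_Th j K) \int[@area R]_(x in tri K) f j K x.

(* Arc-length integral over the part of the interface in [K]; integrands are
   functions of the curve parameter. *)
Definition int_GamK K (f : R -> R) : R :=
  \int[@lebesgue_measure R]_(t in `[0, ilen I] `&` [set t | tri K (ipt I t)])
    f t.
Definition int_Gam (f : elt -> R -> R) : R :=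
  \sum_(K | in_ThG K) int_GamK K (f K).

Definition jmp (q : bool -> R) : R := q minus - q plus.
Definition avg (q : bool -> R) : R := kappa1 * q minus + kappa2 * q plus.

Definition glue u : elt -> R * R -> R * R := fun K x =>
  if `[< iOm I minus x >] then u minus K x
  else if `[< iOm I plus x >] then u plus K x else 0.

Definition g_ndot u K (t : R) (j : bool) : R := dot (inrm I t) (u j K (ipt I t)).
Definition g_ncross u K (t : R) (j : bool) : R :=
  cross (inrm I t) (u j K (ipt I t)).
Definition g_curl u K (t : R) (j : bool) : R := scurl (u j K) (ipt I t).
Definition acurlcurl (j : bool) (w : R * R -> R * R) : R * R -> R * R :=
  fun x => alpha j *: curlcurl w x.
Definition g_ncross_acc u K (t : R) (j : bool) : R :=
  cross (inrm I t) (acurlcurl j (u j K) (ipt I t)).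
Definition g_curl_acc u K (t : R) (j : bool) : R :=
  scurl (acurlcurl j (u j K)) (ipt I t).

Definition G0 u v : R :=
  \sum_(K | in_ThG K) h ^- 3 *
    int_GamK K (fun t => jmp (g_ndot u K t) * jmp (g_ndot v K t)) +
  \sum_(E | in_Eh E) h ^- 3 * edge_int E (fun x =>
    jump xpredT E (fun K y => dot (enrm E) (glue u K y)) x *
    jump xpredT E (fun K y => dot (enrm E) (glue v K y)) x).

Definition G1 u v : R :=
  lambda * \sum_(K | in_ThG K) h ^- 3 *
    int_GamK K (fun t => jmp (g_ncross u K t) * jmp (g_ncross v K t)).

Definition G2 u v : R :=
  lambda * \sum_(K | in_ThG K) h ^- 1 *
    int_GamK K (fun t => jmp (g_curl u K t) * jmp (g_curl v K t)).

Definition J1 u v : R :=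
  \sum_(i : bool) \sum_(E | in_EhG E) \sum_(l < 5) h ^+ (2 * l) / h *
    edge_int E (fun x =>
      dot (jump (in_Th i) E (fun K => vdn (enrm E) l (u i K)) x)
          (jump (in_Th i) E (fun K => vdn (enrm E) l (v i K)) x)).

Definition J2 u v : R :=
  \sum_(i : bool) \sum_(E | in_EhG E) \sum_(l < 5) h ^+ (2 * l) / h *
    edge_int E (fun x =>
      jump (in_Th i) E (fun K => dn (enrm E) l (scurl (u i K))) x *
      jump (in_Th i) E (fun K => dn (enrm E) l (scurl (v i K))) x).

Definition ah u v : R :=
  int_Om (fun j K x =>
    dot (acurlcurl j (u j K) x) (curlcurl (v j K) x) +
    gamma * dot (u j K x) (v j K x))
  + int_Gam (fun K t =>
      avg (g_ncross_acc u K t) * jmp (g_curl v K t) +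
      avg (g_ncross_acc v K t) * jmp (g_curl u K t))
  - int_Gam (fun K t =>
      avg (g_curl_acc u K t) * jmp (g_ncross v K t) +
      avg (g_curl_acc v K t) * jmp (g_ncross u K t))
  + h ^- 2 * int_Om (fun j K x => div2 (u j K) x * div2 (v j K) x)
  + (G0 u v + G1 u v + G2 u v).

Definition Ah u v : R := ah u v + J1 u v + J2 u v.

Definition normh v : R :=
  Num.sqrt (int_Omh (fun j K x => dot (v j K x) (v j K x))).
Definition curl_normh v : R :=
  Num.sqrt (int_Omh (fun j K x => scurl (v j K) x ^+ 2)).

Definition star_norm v : R := Num.sqrt (
  int_Omh (fun j K x => dot (curlcurl (v j K) x) (curlcurl (v j K) x))
  + int_Omh (fun j K x => dot (v j K x) (v j K x))
  + h ^- 2 * int_Om (fun j K x => div2 (v j K) x ^+ 2)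
  + (G0 v v + G1 v v + G2 v v)
  + (J1 v v + J2 v v)).

End MeshInterface.
End Mesh.

Section MatrixNorm.
Variables (R : realType) (N : nat).

Definition ipN (W V : 'cV[R]_N) : R := \sum_i W i 0 * V i 0.
Definition normN (W : 'cV[R]_N) : R := Num.sqrt (ipN W W).
Definition opnorm (A : 'M[R]_N) : R :=
  sup [set r | exists2 W : 'cV[R]_N, W != 0 & r = normN (A *m W) / normN W].
Definition condition_number (A : 'M[R]_N) : R := opnorm A * opnorm (invmx A).

End MatrixNorm.

(* Main.v *)
(** Continuity, the inverse inequality and the upper norm equivalence give
    [(A X, Y) <= K |X| |Y|] with [K ~ h^-4]; coercivity, the Poincare inequality
    and the lower norm equivalence give [(A X, X) >= k |X|^2] with [k ~ h^2].
    Hence [A] is invertible with [|A| <= K] and [|A^-1| <= 1 / k]. Only the mesh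
    has to be inspected for [h > 0]: since [diam] is a supremum, this needs that
    triangles are bounded as well as nondegenerate. *)
Require Import Defs.
From mathcomp Require Import all_boot all_order all_algebra.
From mathcomp Require Import all_classical all_reals all_analysis.
From mathcomp Require Import ring lra.

Set Implicit Arguments.
Unset Strict Implicit.
Unset Printing Implicit Defensive.

Import Order.TTheory GRing.Theory Num.Theory.
Import numFieldNormedType.Exports.

Local Open Scope classical_set_scope.
Local Open Scope ring_scope.

(** * Condition number of a bounded and coercive matrix *)

Section Matrices.
Variables (R : realType) (N : nat).
Implicit Types (X Y : 'cV[R]_N) (A : 'M[R]_N).

Lemma ipN_ge0 X : 0 <= ipN X X.
Proof. by apply: sumr_ge0 => i _; rewrite -expr2 sqr_ge0. Qed.

Lemma normN_ge0 X : 0 <= normN X.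
Proof. exact: sqrtr_ge0. Qed.

Lemma normN_sqr X : normN X ^+ 2 = ipN X X.
Proof. exact/sqr_sqrtr/ipN_ge0. Qed.

Lemma normN_eq0 X : normN X = 0 -> X = 0.
Proof.
move=> X0; have XX0 : ipN X X = 0 by rewrite -normN_sqr X0 expr0n.
apply/colP => i; rewrite mxE; apply/eqP.
rewrite -sqrf_eq0 expr2; apply/eqP.
by apply: (psumr_eq0P _ XX0) => // j _; rewrite -expr2 sqr_ge0.
Qed.

Lemma normN0 : normN (0 : 'cV[R]_N) = 0.
Proof. by rewrite /normN /ipN big1 ?sqrtr0 // => i _; rewrite mxE mul0r. Qed.

Lemma normN_gt0 X : X != 0 -> 0 < normN X.
Proof.
by move=> X0; rewrite lt0r normN_ge0 andbT; apply: contra_neq X0; apply: normN_eq0.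
Qed.

(** Cauchy-Schwarz: the squared norm of [normN Y *: X - normN X *: Y] expands to twice
    [normN X * normN Y] times the difference of the two sides. *)
Lemma ipN_le_normN X Y : ipN X Y <= normN X * normN Y.
Proof.
have [->|X0] := eqVneq X 0.
  by rewrite normN0 mul0r /ipN big1 // => i _; rewrite mxE mul0r.
have [->|Y0] := eqVneq Y 0.
  by rewrite normN0 mulr0 /ipN big1 // => i _; rewrite mxE mulr0.
have XY_gt0 : 0 < normN X * normN Y by rewrite mulr_gt0 ?normN_gt0.
have := ipN_ge0 (normN Y *: X - normN X *: Y).
have -> : ipN (normN Y *: X - normN X *: Y) (normN Y *: X - normN X *: Y) =
    normN Y ^+ 2 * ipN X X + normN X ^+ 2 * ipN Y Y
    - 2 * (normN X * normN Y) * ipN X Y.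
  rewrite /ipN !mulr_sumr -sumrN -!big_split /=.
  by apply: eq_bigr => i _; rewrite !mxE; ring.
rewrite -!normN_sqr => ge0; rewrite -subr_ge0 -(pmulr_rge0 _ XY_gt0).
by nra.
Qed.

(** Test the form bound with [Y = A *m X] and cancel one factor [normN (A *m X)]. *)
Lemma normN_mulmx_le A (k : R) : 0 <= k ->
  (forall X Y, ipN (A *m X) Y <= k * normN X * normN Y) ->
  forall X, normN (A *m X) <= k * normN X.
Proof.
move=> k0 kP X; have [->|AX0] := eqVneq (A *m X) 0.
  by rewrite normN0 mulr_ge0 ?normN_ge0.
by rewrite -(ler_pM2r (normN_gt0 AX0)) -expr2 normN_sqr.
Qed.

Lemma normN_mulmx_ge A (k : R) :
  (forall X, k * normN X ^+ 2 <= ipN (A *m X) X) ->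
  forall X, k * normN X <= normN (A *m X).
Proof.
move=> kP X; have [->|X0] := eqVneq X 0.
  by rewrite mulmx0 normN0 mulr0.
rewrite -(ler_pM2r (normN_gt0 X0)) -mulrA -expr2.
exact: le_trans (kP X) (ipN_le_normN _ _).
Qed.

Lemma opnorm_bounds A (k : R) : 0 <= k ->
  (forall X, normN (A *m X) <= k * normN X) -> 0 <= opnorm A <= k.
Proof.
move=> k0 kP; rewrite /opnorm; set E := [set r | _].
have kE : ubound E k by move=> _ [X X0 ->]; rewrite ler_pdivrMr ?normN_gt0 ?kP.
(* For [N = 0] there is no nonzero vector, and the supremum of the empty set is 0. *)
have [->|/set0P[r Er]] := eqVneq E set0; first by rewrite sup0 lexx.
apply/andP; split; last by apply: ge_sup => //; exists r.
apply: (@le_trans _ _ r); last by apply: ub_le_sup => //; exists k.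
by case: Er => X _ ->; rewrite divr_ge0 ?normN_ge0.
Qed.

(** The lower bound makes the kernel trivial. Row freeness concerns row vectors, so it is applied to
    the transpose of [A]. *)
Lemma coercive_unitmx A (k : R) : 0 < k ->
  (forall X, k * normN X <= normN (A *m X)) -> A \in unitmx.
Proof.
move=> k0 kP; rewrite -unitmx_tr -row_free_unit; apply: inj_row_free => v vA0.
apply: (can_inj (@trmxK _ _ _)); rewrite trmx0; apply: normN_eq0; apply/eqP.
rewrite eq_le normN_ge0 andbT -(pmulr_rle0 _ k0) (le_trans (kP _)) //.
by rewrite -[A]trmxK -trmx_mul vA0 trmx0 normN0.
Qed.

Lemma condition_number_le A (k K : R) : 0 < k -> 0 <= K ->
  (forall X, k * normN X ^+ 2 <= ipN (A *m X) X) ->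
  (forall X Y, ipN (A *m X) Y <= K * normN X * normN Y) ->
  A \in unitmx /\ condition_number A <= K / k.
Proof.
move=> k0 K0 /normN_mulmx_ge lowA /(normN_mulmx_le K0) upA.
have Au := coercive_unitmx k0 lowA; split => //.
(* This is the lower bound for [A] at the vector [invmx A *m X]. *)
have upV X : normN (invmx A *m X) <= k^-1 * normN X.
  by rewrite ler_pdivlMl // (le_trans (lowA _)) // mulKVmx.
have /andP[A0 AK] := opnorm_bounds K0 upA.
have /andP[V0 Vk] : 0 <= opnorm (invmx A) <= k^-1.
  by apply: opnorm_bounds; rewrite // invr_ge0 ltW.
exact: ler_pM.
Qed.

End Matrices.

(** * Positivity of the mesh size *)

Section MeshSize.
Variable R : realType.

Lemma enorm_le (u : R * R) : enorm u <= `|u.1| + `|u.2|.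
Proof.
rewrite -[leRHS]ger0_norm ?addr_ge0 // -sqrtr_sqr ler_sqrt ?sqr_ge0 //.
rewrite /dot -!expr2 sqrrD !real_normK ?num_real //.
by rewrite lerD2r lerDl mulrn_wge0 // mulr_ge0.
Qed.

Lemma enorm_gt0 (u : R * R) : u != 0 -> 0 < enorm u.
Proof.
case: u => a b; rewrite sqrtr_gt0 /dot /= -!expr2 => u0.
rewrite lt0r addr_ge0 ?sqr_ge0 // andbT paddr_eq0 ?sqr_ge0 // !sqrf_eq0.
by apply: contra_neqN u0 => /andP[/eqP -> /eqP ->].
Qed.

(** Convex weights lie between 0 and 1. The bound is crude, but it shows that hulls are bounded. *)
Lemma hull_coord_le (T : finType) (S : {set T}) (p : T -> R * R) x :
  hull S p x -> `|x.1| <= \sum_i `|(p i).1| /\ `|x.2| <= \sum_i `|(p i).2|.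
Proof.
move=> [w [w0 _ w1 ->]].
have wle1 i : w i <= 1.
  by rewrite -w1 (bigD1 i) //= lerDl sumr_ge0.
rewrite (big_morph (@fst R R) (id1 := 0) (op1 := +%R)) //.
rewrite (big_morph (@snd R R) (id1 := 0) (op1 := +%R)) //.
by split; apply: (le_trans (ler_norm_sum _ _ _)); apply: ler_sum => i _ /=;
  rewrite normrM (ger0_norm (w0 i)) ler_piMl.
Qed.

Lemma mem_hull (T : finType) (S : {set T}) (p : T -> R * R) i :
  i \in S -> hull S p (p i).
Proof.
move=> iS; exists (fun j => (j == i)%:R); split.
- by move=> j; rewrite ler0n.
- by move=> j; apply: contraNeq; rewrite pnatr_eq0 eqb0 negbK => /eqP ->.
- by rewrite (bigD1 i) //= eqxx big1 ?addr0 // => j /negPf ->.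
- rewrite (bigD1 i) //= eqxx scale1r big1 ?addr0 // => j /negPf ->.
  by rewrite scale0r.
Qed.

(** A real [sup] dominates its set only if that set is bounded above; the coordinate bounds supply
    this. *)
Lemma enorm_le_diam_hull (T : finType) (S : {set T}) (p : T -> R * R) x y :
  hull S p x -> hull S p y -> enorm (x - y) <= diam (hull S p).
Proof.
move=> Sx Sy; apply: ub_le_sup; last by exists x, y.
exists ((\sum_i `|(p i).1| + \sum_i `|(p i).1|) +
        (\sum_i `|(p i).2| + \sum_i `|(p i).2|)).
move=> _ [a [b [/hull_coord_le[a1 a2] /hull_coord_le[b1 b2] ->]]].
apply: le_trans (enorm_le _) _; apply: lerD;
  by apply: le_trans (ler_normB _ _) _; apply: lerD.
Qed.

(** Covering a point of [Omega] takes at least one triangle, and two of its vertices are distinct,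
    since otherwise its cross product would vanish. *)
Lemma mesh_size_gt0 (M : mesh R) (Omega : set (R * R)) :
  Omega !=set0 -> triangulation M Omega -> 0 < mesh_size M.
Proof.
move=> [x Ox] [_ nondeg coverO _].
have := subset_closure Ox; rewrite -coverO.
move=> [K _ _]; apply: lt_le_trans (le_bigmax _ _ K).
apply: lt_le_trans (enorm_le_diam_hull _ _); last 2 first.
- by apply: mem_hull; apply/imsetP; exists 1.
- by apply: mem_hull; apply/imsetP; exists 0.
apply: enorm_gt0; apply: contra_neq (nondeg K) => d0.
by rewrite /vtx d0 /cross !mul0r subr0.
Qed.

End MeshSize.

(** * The bound for the stiffness matrix *)

Theorem theorem6p4 (R : realType) (Omega : set (R * R))
    (hOmega : convex_polygon Omega)
    (alpha : bool -> R) (halpha : forall j, 0 < alpha j)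
    (gamma : R) (hgamma : 0 <= gamma)
    (kappa1 kappa2 : R) (hkappa : kappa1 + kappa2 = 1)
    (sigma rho : R) (hsigma : 0 < sigma) (hrho : 0 < rho) (m : nat) :
  exists2 lambda0 : R, 0 < lambda0 &
  forall lambda : R, lambda0 <= lambda ->
  forall c1 c2 C1 C2 CI CP : R,
    0 < c1 -> 0 < c2 -> 0 < C1 -> 0 < C2 -> 0 < CI -> 0 < CP ->
  forall (I : interface R) (M : mesh R),
    is_interface Omega I ->
    triangulation M Omega -> shape_regular M sigma -> quasi_uniform M rho ->
    mesh_assumption1 M I -> mesh_assumption2 M I m ->
  let h := mesh_size M in
  let V := @Vh R M Omega I in
  let Aform := @Ah R M Omega I alpha gamma kappa1 kappa2 lambda in
  let star := @star_norm R M Omega I lambda in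
  let L2h := @normh R M I in
  let curlL2h := @curl_normh R M I in
  forall (N : nat) (phi : 'I_N -> pwfun M), Vh_basis Omega I phi ->
  forall A : 'M[R]_N,
    (forall X Y : 'cV[R]_N,
       ipN (A *m X) Y = Aform (lincomb phi X) (lincomb phi Y)) ->
    (forall w v, V w -> V v -> `|Aform w v| <= c2 * star w * star v) ->
    (forall w, V w -> Aform w w >= c1 * star w ^+ 2) ->
    (forall X : 'cV[R]_N, L2h (lincomb phi X) <= C2 * normN X) ->
    (forall X : 'cV[R]_N,
       L2h (lincomb phi X) + curlL2h (lincomb phi X) >= h * C1 * normN X) ->
    (forall v, V v -> star v <= CI * h ^- 2 * L2h v) ->
    (forall v, V v -> star v >= CP * (L2h v + curlL2h v)) ->
  A \in unitmx /\
  condition_number A <= (c2 * C2 ^+ 2 * CI ^+ 2) / (c1 * C1 ^+ 2 * CP ^+ 2) * h ^- 6.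
Proof.
(* Any positive threshold serves: coercivity, which a large [lambda] is meant to secure, is among
   the assumed estimates. *)
exists 1 => // lambda _ c1 c2 C1 C2 CI CP c1_gt0 c2_gt0 C1_gt0 C2_gt0 CI_gt0.
move=> CP_gt0 I M _ meshM _ _ _ _ h V Aform star L2h curlL2h N phi [_ spanV] A.
move=> AE bndA coerA L2le L2ge starle starge.
have h_gt0 : 0 < h by apply: mesh_size_gt0 meshM; case: hOmega.
have Vphi X : V (lincomb phi X) by apply/spanV; exists X.
(* [Num.sqrt] is nonnegative whatever the sign of its argument. *)
have star_ge0 v : 0 <= star v := sqrtr_ge0 _.
have star_up X : star (lincomb phi X) <= CI * h ^- 2 * C2 * normN X.
  apply: le_trans (starle _ (Vphi X)) _.
  by rewrite -[leRHS]mulrA ler_wpM2l ?L2le // mulr_ge0 ?invr_ge0 ?exprn_ge0 // ltW.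
have star_low X : CP * (h * C1) * normN X <= star (lincomb phi X).
  by apply: le_trans (starge _ (Vphi X)); rewrite -mulrA ler_wpM2l ?L2ge // ltW.
(* Both constants are squared because the form is quadratic in the star norm. Their quotient has the
   power [h ^- 4 / h ^+ 2], that is [h ^- 6], and equals the claimed bound exactly. *)
have := @condition_number_le _ _ A (c1 * (CP * (h * C1)) ^+ 2)
  (c2 * (CI * h ^- 2 * C2) ^+ 2).
case.
- by rewrite mulr_gt0 ?exprn_gt0 ?mulr_gt0.
- by rewrite mulr_ge0 ?sqr_ge0 // ltW.
- move=> X; rewrite AE (le_trans _ (coerA _ (Vphi X))) //.
  rewrite -mulrA ler_pM2l // -exprMn ler_pXn2r ?nnegrE //.
  by rewrite mulr_ge0 ?normN_ge0 // ltW ?mulr_gt0.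
- move=> X Y; rewrite AE (le_trans (ler_norm _)) //.
  apply: le_trans (bndA _ _ (Vphi X) (Vphi Y)) _.
  rewrite -!mulrA ler_pM2l //.
  apply: le_trans (ler_pM _ _ (star_up X) (star_up Y)) _ => //.
  by rewrite le_eqVlt; apply/orP; left; apply/eqP; ring.
move=> uA /le_trans kA; split => //; apply: kA.
rewrite le_eqVlt; apply/orP; left; apply/eqP; field.
by rewrite !gt_eqF.
Qed.
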